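(* For each $x\in(0,\infty)$, as $m,n\to\infty$, the bias of the Szasz estimator satisfies $$\operatorname{Bias}\left[\hat F^S_{m,n}(x)\right]=\mathbb{E}\left[\hat F^S_{m,n}(x)\right]-F(x)=m^{-1}\frac{xf'(x)}{2}+o_x(m^{-1})=m^{-1}b^S(x)+o_x(m^{-1}),$$ and its variance satisfies $$\operatorname{Var}\left[\hat F^S_{m,n}(x)\right]=n^{-1}\sigma^2(x)-m^{-1/2}n^{-1}V^S(x)+o_x(m^{-1/2}n^{-1}),$$ where $\sigma^2(x)=F(x)(1-F(x))$, $V^S(x)=f(x)\left[\frac{x}{\pi}\right]^{1/2}$ and $b^S(x)=\frac{xf'(x)}{2}$.
   Context: Let $X_1,X_2,\dots$ be i.i.d. random variables with values in $[0,\infty)$, with distribution function $F$ ($F(0)=0$) and density $f$. Standing assumption: $F$ is continuous, and the first and second derivatives $f=F'$ and $f'=F''$ of $F$ exist and are continuous and bounded on $[0,\infty)$. The empirical distribution function is $F_n(x)=\frac1n\sum_{i=1}^n \mathbb{I}(X_i\le x)$. For $m\in\mathbb{N}$, $m\geq 1$, $k\in\{0,1,2,\dots\}$ and $x\ge 0$ let $V_{k,m}(x)=e^{-mx}\frac{(mx)^k}{k!}$ (with $0^0=1$). The Szasz estimator is $\hat F^S_{m,n}(x)=\sum_{k=0}^\infty F_n\left(\frac km\right)V_{k,m}(x)$. The notation $u=o_x(v)$ means $\lim|u/v|=0$ as $m,n\to\infty$, where the rate of convergence may depend on $x$. *)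

(* Defs.v *)
From HB Require Import structures.
From mathcomp Require Import all_boot all_order all_algebra.
From mathcomp Require Import finmap.
From mathcomp Require Import all_classical all_reals all_analysis.

Set Implicit Arguments.
Unset Strict Implicit.
Unset Printing Implicit Defensive.

Import Order.TTheory GRing.Theory Num.Theory.
Import numFieldNormedType.Exports.

Local Open Scope classical_set_scope.
Local Open Scope ring_scope.

Section iid.
Context {d : measure_display} {T : measurableType d} {R : realType}.
Variable P : probability T R.

Definition mutually_independent (I : choiceType) (X : I -> {RV P >-> R}) : Prop :=
  forall (J : {fset I}) (A : I -> set R),
    (forall i, i \in J -> measurable (A i)) ->
    P (\bigcap_(i in [set` J]) (X i @^-1` A i)) =
    (\prod_(i <- J) P (X i @^-1` A i))%E.

Definition identically_distributed (I : Type) (X : I -> {RV P >-> R}) : Prop :=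
  forall (i j : I) (A : set R), measurable A ->
    distribution P (X i) A = distribution P (X j) A.

Definition iid (I : choiceType) (X : I -> {RV P >-> R}) : Prop :=
  mutually_independent X /\ identically_distributed X.

End iid.

Section derivative_on.
Context {R : realType}.

(* The difference quotient is restricted to D, so at an endpoint belonging
   to D the derivative is the one-sided one. *)
Definition has_derivative_on (D : set R) (g g' : R -> R) : Prop :=
  forall x, D x ->
    (g y - g x) / (y - x) @[y --> within D x^'] --> g' x.

Definition continuous_bounded_on (D : set R) (g : R -> R) : Prop :=
  {within D, continuous g} /\ [bounded g x | x in D].

End derivative_on.

Section szasz.
Context {d : measure_display} {T : measurableType d} {R : realType}.
Context {P : probability T R}.

(* The sequence is indexed from 0: X i is the observation X_{i+1}. *)
Definition empirical_cdf (X : nat -> {RV P >-> R}) (n : nat) (y : R) (w : T) : R :=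
  n%:R^-1 * \sum_(i < n) (X i w <= y)%R%:R.

Definition szasz_weight (k m : nat) (x : R) : R :=
  expR (- (m%:R * x)) * ((m%:R * x) ^+ k / k`!%:R).

Definition szasz_estimator (X : nat -> {RV P >-> R}) (m n : nat) (x : R) (w : T) : R :=
  limn (series (fun k =>
    empirical_cdf X n (k%:R / m%:R) w * szasz_weight k m x)).

End szasz.

Section moments.
Context {d : measure_display} {T : measurableType d} {R : realType}.

Definition bias (P : probability T R) (Y : T -> R) (theta : R) : R :=
  fine 'E_P[Y] - theta.

Definition var (P : probability T R) (Y : T -> R) : R := fine 'V_P[Y].

End moments.

Section asymptotics.
Context {R : realType}.

(* The limit is the joint one: m and n tend to infinity independently of each
   other. *)
Definition is_o_joint (u v : nat -> nat -> R) : Prop :=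
  `|u mn.1 mn.2 / v mn.1 mn.2| @[mn --> filter_prod \oo \oo] --> (0 : R).

Definition sigma2 (F : R -> R) (x : R) : R := F x * (1 - F x).

Definition VS (f : R -> R) (x : R) : R := f x * Num.sqrt (x / pi).

Definition bS (f' : R -> R) (x : R) : R := x * f' x / 2.

End asymptotics.

(* Main.v *)
(* The Szasz weights are the Poisson(m x) probabilities, so the estimator is
   E F_n(K/m) for K Poisson(m x) independent of the sample.  Its bias is
   E F(K/m) - F(x), obtained from a second order Taylor expansion of F at x and
   the second and fourth central moments of K.  Exchanging expectations, its
   variance is (E F(min(K,L)/m) - (E F(K/m))^2) / n with K, L independent
   Poisson(m x), and min(K,L) = (K + L - |K - L|) / 2 reduces the second claim
   to E|K - L| = 2 sqrt(m x / pi) + O(1).  Given K + L = N, which is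
   Poisson(2 m x), K - L is distributed as the simple random walk at time N,
   whose mean absolute value e_N satisfies e_(2n+2) = e_(2n+1) = 1 / W_(2n+1)
   for the Wallis integrals W_n, hence |e_N^2 - 2 N / pi| <= 2 / pi. *)
Require Import Defs.
From mathcomp Require Import all_boot all_order all_algebra.
From mathcomp Require Import all_classical all_reals all_analysis.
From mathcomp Require Import ring lra finmap measurable_realfun.

Set Implicit Arguments.
Unset Strict Implicit.
Unset Printing Implicit Defensive.

Import Order.TTheory GRing.Theory Num.Theory.
Import numFieldNormedType.Exports.

Local Open Scope classical_set_scope.
Local Open Scope ring_scope.

(** * Poisson means *)

Section poisson_mean.
Context {R : realType}.
Implicit Types (lam s t : R) (a b : nat -> R) (k : nat).

(** [szasz_weight k m x] is convertible to [pois (m%:R * x) k], so results on Poisson means apply to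
    the estimator without rewriting. *)
Definition pois lam k : R := expR (- lam) * (lam ^+ k / k`!%:R).

(** A relation that carries convergence with it, since [limn] of a divergent series is an arbitrary
    default value. *)
Definition has_mean lam a s : Prop :=
  let u := series (fun k => a k * pois lam k) in cvgn u /\ limn u = s.

Lemma has_meanP lam a s :
  has_mean lam a s <-> series (fun k => a k * pois lam k) @ \oo --> s.
Proof.
by split=> [[cu <-]//|cu]; split; [exact: cvgP cu|exact: cvg_lim].
Qed.

Lemma pois_ge0 lam k : 0 <= lam -> 0 <= pois lam k.
Proof. by move=> l0; rewrite mulr_ge0 ?expR_ge0// divr_ge0// exprn_ge0. Qed.

Lemma has_mean_ext lam a b s : a =1 b -> has_mean lam a s -> has_mean lam b s.
Proof. by move=> /funext ->. Qed.

Lemma has_mean_unique lam a s t : has_mean lam a s -> has_mean lam a t -> s = t.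
Proof. by move=> [_ <-] [_]. Qed.

Lemma has_meanD lam a b s t : has_mean lam a s -> has_mean lam b t ->
  has_mean lam (fun k => a k + b k) (s + t).
Proof.
move=> /has_meanP ha /has_meanP hb; apply/has_meanP.
have -> : (fun k => (a k + b k) * pois lam k) =
    (fun k => a k * pois lam k) + (fun k => b k * pois lam k).
  by apply/funext => k; rewrite mulrDl.
by rewrite seriesD; exact: cvgD.
Qed.

Lemma has_meanZ c lam a s : has_mean lam a s ->
  has_mean lam (fun k => c * a k) (c * s).
Proof.
move=> /has_meanP ha; apply/has_meanP.
have -> : (fun k => c * a k * pois lam k) = c *: (fun k => a k * pois lam k).
  by apply/funext => k; rewrite -mulrA.
by rewrite seriesZ; exact: cvgZr.
Qed.

Lemma has_meanB lam a b s t : has_mean lam a s -> has_mean lam b t ->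
  has_mean lam (fun k => a k - b k) (s - t).
Proof.
move=> ha /(has_meanZ (-1)); rewrite mulN1r => hb.
by apply: has_mean_ext (has_meanD ha hb) => k; rewrite mulN1r.
Qed.

Lemma has_mean_le lam a b s t : 0 <= lam -> (forall k, a k <= b k) ->
  has_mean lam a s -> has_mean lam b t -> s <= t.
Proof.
move=> l0 ab [ca <-] [cb <-]; apply: ler_lim => //; apply: nearW => n.
by apply: ler_sum => k _; rewrite ler_wpM2r ?pois_ge0.
Qed.

(** The comparison test; it supplies the existence of means that have no closed form, together with
    a bound. *)
Lemma has_mean_dominated lam a b t : 0 <= lam ->
  (forall k, `|a k| <= b k) -> has_mean lam b t ->
  exists2 s, has_mean lam a s & `|s| <= t.
Proof.
move=> l0 ab [cb <-].
have nab k : `|a k * pois lam k| <= b k * pois lam k.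
  by rewrite normrM (ger0_norm (pois_ge0 k l0)) ler_wpM2r ?pois_ge0.
have cn : cvgn [normed series (fun k => a k * pois lam k)].
  apply: (@series_le_cvg _ _ (fun k => b k * pois lam k)) => // k; first exact: normr_ge0.
  exact: le_trans (normr_ge0 _) (nab k).
have ca : cvgn (series (fun k => a k * pois lam k)) by exact: normed_cvg.
exists (limn (series (fun k => a k * pois lam k))) => //.
by apply: le_trans (lim_series_norm cn) _; exact: lim_series_le.
Qed.

Lemma has_mean_cst lam c : has_mean lam (fun=> c) c.
Proof.
rewrite -[c in X in _ X]mulr1.
apply: (@has_mean_ext _ (fun=> c * 1)) => [k|]; first by rewrite mulr1.
apply/has_meanZ/has_meanP.
have -> : (fun k => 1 * pois lam k) = expR (- lam) *: exp_coeff lam.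
  by apply/funext => k; rewrite mul1r.
have -> : 1 = expR (- lam) *: expR lam by rewrite /GRing.scale/= mulrC expRxMexpNx_1.
rewrite seriesZ; apply: cvgZr.
exact: is_cvg_series_exp_coeff.
Qed.

Lemma pois_succ lam k : k.+1%:R * pois lam k.+1 = lam * pois lam k.
Proof.
rewrite /pois factS natrM exprS.
have k0 : k`!%:R != 0 :> R by rewrite pnatr_eq0 -lt0n fact_gt0.
have k1 : k.+1%:R != 0 :> R by rewrite pnatr_eq0.
by field; rewrite k0 nat1r.
Qed.

(** The Stein-Chen identity: the term k = 0 vanishes, and in the others the factor k cancels against
    k!. *)
Lemma has_mean_shift lam a s : has_mean lam (fun k => a k.+1) s ->
  has_mean lam (fun k => k%:R * a k) (lam * s).
Proof.
move=> /has_meanP ha; apply/has_meanP; rewrite -(cvg_shiftS (series _)).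
have -> : [sequence series (fun k => k%:R * a k * pois lam k) n.+1]_n =
    series (lam *: (fun k => a k.+1 * pois lam k)).
  apply/funext => n; rewrite /series/= big_nat_recl// !mul0r add0r.
  apply: eq_bigr => k _; rewrite mulrAC pois_succ.
  by rewrite -mulrA (mulrC _ (a _)).
by rewrite seriesZ; exact: cvgZr.
Qed.

Lemma has_mean_id lam : has_mean lam (fun k => k%:R) lam.
Proof.
have h := has_mean_shift (a := fun=> 1) (has_mean_cst lam 1).
by rewrite mulr1 in h; apply: has_mean_ext h => k; rewrite mulr1.
Qed.

(** Factorial moments by induction: remove the first factor k with [has_mean_shift]; the remaining
    factors, taken at k + 1, form the product for r. The factors are real, so no truncated
    subtraction occurs. *)
Lemma has_mean_ffact lam r :
  has_mean lam (fun k => \prod_(i < r) (k%:R - i%:R)) (lam ^+ r).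
Proof.
elim: r => [|r ih].
  by apply: has_mean_ext (has_mean_cst lam 1) => k; rewrite big_ord0.
rewrite exprS; apply: has_mean_ext (has_mean_shift
  (a := fun k => \prod_(i < r) (k%:R - i.+1%:R)) _) => [k|].
  by rewrite big_ord_recl subr0; congr (_ * _); apply: eq_bigr => i _; rewrite lift0.
apply: has_mean_ext ih => k; apply: eq_bigr => i _.
by rewrite -[in RHS]natr1 -[in RHS]natr1; ring.
Qed.

Lemma has_mean_sqr lam : has_mean lam (fun k => (k%:R - lam) ^+ 2) lam.
Proof.
have h := has_meanD (has_meanD (has_mean_ffact lam 2)
  (has_meanZ (1 - 2 * lam) (has_mean_id lam))) (has_mean_cst lam (lam ^+ 2)).
have e : lam ^+ 2 + (1 - 2 * lam) * lam + lam ^+ 2 = lam by ring.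
rewrite e in h; apply: has_mean_ext h => k.
by rewrite !big_ord_recr big_ord0/=; ring.
Qed.

(** The coefficients expand (k - lam)^4 in falling factorials, using k^4 = (k)_4 + 6 (k)_3 + 7 (k)_2
    + k and k^3 = (k)_3 + 3 (k)_2 + k. *)
Lemma has_mean_pow4 lam :
  has_mean lam (fun k => (k%:R - lam) ^+ 4) (lam + 3 * lam ^+ 2).
Proof.
have h := has_meanD (has_meanD (has_meanD (has_meanD (has_mean_ffact lam 4)
  (has_meanZ (6 - 4 * lam) (has_mean_ffact lam 3)))
  (has_meanZ (7 - 12 * lam + 6 * lam ^+ 2) (has_mean_ffact lam 2)))
  (has_meanZ (1 - 4 * lam + 6 * lam ^+ 2 - 4 * lam ^+ 3) (has_mean_id lam)))
  (has_mean_cst lam (lam ^+ 4)).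
have e : lam ^+ 4 + (6 - 4 * lam) * lam ^+ 3 +
  (7 - 12 * lam + 6 * lam ^+ 2) * lam ^+ 2 +
  (1 - 4 * lam + 6 * lam ^+ 2 - 4 * lam ^+ 3) * lam + lam ^+ 4 =
  lam + 3 * lam ^+ 2 by ring.
rewrite e in h; apply: has_mean_ext h => k.
by rewrite !big_ord_recr !big_ord0/=; ring.
Qed.

End poisson_mean.

(** * Expectation of a Poisson-weighted series *)

(** With its converse below, this moves nonnegative real series to extended reals, where sums and
    integrals may be exchanged freely. *)
Lemma cvg_series_nneseries {R : realType} (u : nat -> R) (s : R) :
  (forall k, 0 <= u k) -> (\sum_(k <oo) (u k)%:E)%E = s%:E ->
  series u @ \oo --> s.
Proof.
move=> u0 us.
have cu : (fun n => (\sum_(0 <= k < n) (u k)%:E)%E) @ \oo --> s%:E.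
  by rewrite -us; apply: is_cvg_nneseries => n _ _; rewrite lee_fin.
apply: cvg_trans (fine_cvg cu); apply: near_eq_cvg; apply: nearW => n /=.
by rewrite sumEFin.
Qed.

Lemma nneseries_cvg_series {R : realType} (u : nat -> R) (s : R) :
  series u @ \oo --> s -> (\sum_(k <oo) (u k)%:E)%E = s%:E.
Proof.
move=> us; apply: cvg_lim => //.
rewrite (_ : (fun n => _) = EFin \o series u); last first.
  by apply/funext => n /=; rewrite sumEFin.
by apply: cvg_EFin; first exact: nearW.
Qed.

Section expectation_of_series.
Context {d : measure_display} {T : measurableType d} {R : realType}.
Variable P : probability T R.
Implicit Types (Y Z : T -> R).

(** A class of integrable variables closed under products and Poisson means; it contains the
    estimator and all products formed from it below. *)
Definition unit_mfun Y : Prop :=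
  measurable_fun setT Y /\ forall w, 0 <= Y w <= 1.

Lemma unit_mfun_Lfun1 Y : unit_mfun Y -> Y \in Lfun P 1.
Proof.
move=> [mY Y01]; apply/Lfun1_integrable.
apply: measurable_bounded_integrable => //; first exact: fin_num_fun_lty.
exists 1; split=> // M M1 w _ /=; apply: le_trans (ltW M1).
by rewrite ger0_norm; case/andP: (Y01 w).
Qed.

Lemma unit_mfunM Y Z : unit_mfun Y -> unit_mfun Z -> unit_mfun (fun w => Y w * Z w).
Proof.
move=> [mY Y01] [mZ Z01]; split; first exact: measurable_funM.
move=> w; case/andP: (Y01 w) (Z01 w) => Y0 Y1 /andP[Z0 Z1].
by rewrite mulr_ge0// mulr_ile1.
Qed.

Lemma fine_expectation_unit Y : unit_mfun Y -> 0 <= fine 'E_P[Y] <= 1.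
Proof.
move=> uY; have [mY Y01] := uY.
have fY : ('E_P[Y] \is a fin_num)%E by exact/expectation_fin_num/unit_mfun_Lfun1.
rewrite -!lee_fin fineK// expectation_ge0 => [|w]; last by case/andP: (Y01 w).
rewrite -(expectation_cst P 1); apply: expectation_le => //.
  by move=> w; case/andP: (Y01 w).
by apply: (aeW P) => w; case/andP: (Y01 w).
Qed.

(** Tonelli's theorem for the Poisson sum and the expectation. Pointwise convergence comes from
    domination by the constant 1. *)
Lemma expectation_pois_series (lam : R) (a : nat -> T -> R) :
  0 <= lam -> (forall k, unit_mfun (a k)) ->
  let S w := limn (series (fun k => a k w * pois lam k)) in
  [/\ unit_mfun S, forall w, has_mean lam (a ^~ w) (S w) &
      has_mean lam (fun k => fine 'E_P[a k]) (fine 'E_P[S])].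
Proof.
move=> l0 ua S.
have a0 k w : 0 <= a k w by case/andP: ((ua k).2 w).
have a1 k w : a k w <= 1 by case/andP: ((ua k).2 w).
have hS w : has_mean lam (a ^~ w) (S w).
  have [|s [ca _] _] := has_mean_dominated (a := a ^~ w) l0 _ (has_mean_cst lam 1).
    by move=> k; rewrite ger0_norm.
  by split.
have S01 w : 0 <= S w <= 1.
  by rewrite (has_mean_le l0 _ (has_mean_cst lam 0) (hS w))//
             (has_mean_le l0 _ (hS w) (has_mean_cst lam 1)).
have mS : measurable_fun setT S.
  apply: (@measurable_realfun.measurable_fun_cvg _ _ _ _
    (fun n w => series (fun k => a k w * pois lam k) n)) => [n|w _].
    apply: measurable_sum => k; apply: measurable_funM => //.
    by case: (ua k).
  exact/has_meanP.
have uS : unit_mfun S by [].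
split=> //; apply/has_meanP; apply: cvg_series_nneseries => [k|].
  by rewrite mulr_ge0 ?pois_ge0//; case/andP: (fine_expectation_unit (ua k)).
have fin Y : unit_mfun Y -> ('E_P[Y] \is a fin_num)%E.
  by move=> uY; exact/expectation_fin_num/unit_mfun_Lfun1.
rewrite fineK ?fin// [in RHS]unlock.
(* The integrand becomes an extended-real series of nonnegative terms, so that [integral_nneseries]
   applies. *)
transitivity (\int[P]_w (\sum_(k <oo) (a k w * pois lam k)%:E)%E)%E; last first.
  by apply: eq_integral => w _; apply: nneseries_cvg_series; exact/has_meanP.
rewrite integral_nneseries//; last 2 first.
- move=> k; apply/measurable_EFinP; apply: measurable_funM => //.
  by case: (ua k).
- by move=> k w _; rewrite lee_fin mulr_ge0// pois_ge0.
apply: eq_eseriesr => k _; rewrite EFinM fineK ?fin//.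
rewrite [in LHS]unlock; under [RHS]eq_integral do rewrite mulrC EFinM.
rewrite ge0_integralZl_EFin ?pois_ge0//; first by rewrite muleC.
- by move=> w _; rewrite lee_fin.
- by apply/measurable_EFinP; case: (ua k).
Qed.

Lemma fine_expectation_sum (n : nat) (Y : 'I_n -> T -> R) :
  (forall i, Y i \in Lfun P 1) ->
  fine 'E_P[fun w => \sum_(i < n) Y i w] = \sum_(i < n) fine 'E_P[Y i].
Proof.
move=> LY.
have -> : (fun w => \sum_(i < n) Y i w) = \sum_(Z <- [seq Y i | i <- enum 'I_n]) Z.
  by apply/funext => w; rewrite fct_sumE big_map big_enum.
rewrite expectation_sum => [|Z /mapP[i _ ->]//].
rewrite big_map big_enum/= sum_fine// => i _.
exact: expectation_fin_num.
Qed.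

Lemma fine_expectationZ c Y : Y \in Lfun P 1 ->
  fine 'E_P[fun w => c * Y w] = c * fine 'E_P[Y].
Proof.
move=> LY; rewrite (_ : (fun w => c * Y w) = c \o* Y); last first.
  by apply/funext => w /=; rewrite mulrC.
by rewrite expectationZl// fineM// expectation_fin_num.
Qed.

Lemma var_unit_mfun Y : unit_mfun Y ->
  var P Y = fine 'E_P[fun w => Y w * Y w] - fine 'E_P[Y] ^+ 2.
Proof.
move=> uY; have LY := unit_mfun_Lfun1 uY.
have LYY := unit_mfun_Lfun1 (unit_mfunM uY uY).
have fY := expectation_fin_num LY.
have fYY := expectation_fin_num LYY.
rewrite /var /variance covarianceE// fineB// ?fin_numM//.
by rewrite fineM// expr2.
Qed.

End expectation_of_series.

(** * Mean and variance of the Szasz estimator *)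

Section szasz_moments.
Context {d : measure_display} {T : measurableType d} {R : realType}.
Variables (P : probability T R) (X : nat -> {RV P >-> R}) (F : R -> R).
Hypothesis X_iid : iid X.
Hypothesis X_cdf : forall r, cdf (X 0%N) r = (F r)%:E.

Let event (i : nat) (y : R) : set T := X i @^-1` `]-oo, y].

Let measurable_event i y : measurable (event i y).
Proof. exact: measurable_funPTI. Qed.

Let indic_event i y : (fun w => (X i w <= y)%R%:R) = \1_(event i y) :> (T -> R).
Proof.
apply/funext => w; rewrite indicE; congr (nat_of_bool _)%:R.
apply/idP/idP => [h|/set_mem].
  by apply/mem_set; rewrite /event/= in_itv.
by rewrite /event/= in_itv.
Qed.

Let unit_mfun_event i y : unit_mfun (fun w => (X i w <= y)%R%:R : R).
Proof.
split; first by rewrite indic_event; exact: measurable_indic.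
by move=> w; case: (X i w <= y); rewrite lexx ler01.
Qed.

Let prob_event i y : P (event i y) = (F y)%:E.
Proof.
rewrite -X_cdf; have [_ X_id] := X_iid.
by rewrite -[LHS]/(distribution P (X i) _) (X_id i 0%N).
Qed.

Let expectation_indicM i j s t :
  fine 'E_P[fun w => (X i w <= s)%R%:R * (X j w <= t)%R%:R] =
  if i == j then F (Num.min s t) else F s * F t.
Proof.
have -> : (fun w => (X i w <= s)%R%:R * (X j w <= t)%R%:R) =
    \1_(event i s `&` event j t) :> (T -> R).
  by rewrite indicI -!indic_event.
rewrite expectation_indic; last exact: measurableI.
case: eqVneq => [->|ij].
  rewrite -[RHS]/(fine (F (Num.min s t))%:E) -(prob_event j); congr (fine (P _)).
  by apply/seteqP; split=> w; rewrite /event/= !in_itv/= le_min => /andP.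
have [X_indep _] := X_iid.
(* Mutual independence is used on the pair {i, j}; the half-line attached to an index is selected by
   comparison with i. *)
have := X_indep [fset i; j]%fset
  (fun l => if l == i then [set` `]-oo, s]] else [set` `]-oo, t]]).
rewrite big_fsetU1 ?inE// big_seq_fset1 eqxx eq_sym (negbTE ij).
rewrite -/(event i s) -/(event j t) !prob_event => /(_ _)/wrap[l _|].
  by case: ifP.
move=> Pij; rewrite -[RHS]/(fine (F s * F t)%R%:E) EFinM -Pij; congr (fine (P _)).
apply/seteqP; split=> [w [wi wj] l/=|w wij].
  by rewrite !inE => /orP[/eqP->|/eqP->]; rewrite ?eqxx // eq_sym (negbTE ij).
split.
  by have := wij i; rewrite /= !inE eqxx; apply.
by have := wij j; rewrite /= !inE eqxx orbT eq_sym (negbTE ij); apply.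
Qed.

Let expectation_indic_cdf i s : fine 'E_P[fun w => (X i w <= s)%R%:R] = F s.
Proof. by rewrite indic_event expectation_indic// prob_event. Qed.

Let unit_mfun_empirical_cdf n y : unit_mfun (empirical_cdf X n y).
Proof.
split.
  apply: measurable_funM => //; apply: measurable_sum => i.
  by case: (unit_mfun_event i y).
move=> w; have s0 : 0 <= \sum_(i < n) (X i w <= y)%R%:R :> R by exact: sumr_ge0.
rewrite /empirical_cdf mulr_ge0//=.
have [->|n0] := posnP n; first by rewrite big_ord0 mulr0.
rewrite mulrC ler_pdivrMr ?ltr0n// mul1r.
apply: (@le_trans _ _ (\sum_(i < n) 1)).
  by apply: ler_sum => i _; case: (X i w <= y).
by rewrite sumr_const card_ord.
Qed.

(** Peels off one empirical factor at a time: Y = 1 gives the mean, and Y another empirical factor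
    gives the mixed second moment. *)
Let expectation_mul_empirical_cdf Y n t : unit_mfun Y ->
  fine 'E_P[fun w => Y w * empirical_cdf X n t w] =
  n%:R^-1 * \sum_(i < n) fine 'E_P[fun w => Y w * (X i w <= t)%R%:R].
Proof.
move=> uY.
have LY (i : 'I_n) : (fun w => Y w * (X i w <= t)%R%:R) \in Lfun P 1.
  by apply: unit_mfun_Lfun1; exact: unit_mfunM.
rewrite -fine_expectation_sum// -fine_expectationZ; last first.
  rewrite (_ : (fun _ => _) = \sum_(i < n) (fun w => Y w * (X i w <= t)%R%:R)).
    exact: rpred_sum.
  by apply/funext => w; rewrite fct_sumE.
congr (fine 'E_P[_])%E; apply/funext => w.
by rewrite /empirical_cdf mulrCA mulr_sumr.
Qed.

Let expectation_empirical_cdf n s : (0 < n)%N ->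
  fine 'E_P[empirical_cdf X n s] = F s.
Proof.
move=> n0; have u1 : unit_mfun (cst 1 : T -> R).
  by split=> // w; rewrite /= ler01 lexx.
have -> : empirical_cdf X n s = (fun w => cst 1 w * empirical_cdf X n s w).
  by apply/funext => w; rewrite mul1r.
rewrite expectation_mul_empirical_cdf//.
rewrite (eq_bigr (fun=> F s)) => [|i _]; last first.
  rewrite -(expectation_indic_cdf i s); congr (fine 'E_P[_])%E.
  by apply/funext => w; rewrite mul1r.
by rewrite sumr_const card_ord -[F s *+ n]mulr_natl mulKf// pnatr_eq0 -lt0n.
Qed.

(** Of the n^2 index pairs, the n diagonal ones contribute F (min s t) and the n (n - 1) others F s
    * F t, by independence. *)
Let expectation_empirical_cdfM n s t : (0 < n)%N ->
  fine 'E_P[fun w => empirical_cdf X n s w * empirical_cdf X n t w] =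
  n%:R^-1 * F (Num.min s t) + (1 - n%:R^-1) * (F s * F t).
Proof.
move=> n0; rewrite expectation_mul_empirical_cdf//.
have n0R : n%:R != 0 :> R by rewrite pnatr_eq0 -lt0n.
rewrite (eq_bigr (fun=> n%:R^-1 * (F (Num.min s t) + n.-1%:R * (F s * F t)))).
  rewrite sumr_const card_ord -[X in _ * X]mulr_natl mulKf// -subn1 natrB//.
  by rewrite mulrDr (mulrA _ (_ - _)) mulrBr mulVf// mulr1.
move=> j _.
rewrite (_ : (fun w => _) =
    (fun w => (X j w <= t)%R%:R * empirical_cdf X n s w)); last first.
  by apply/funext => w; rewrite mulrC.
rewrite expectation_mul_empirical_cdf//; congr (_ * _).
rewrite (bigD1 j)//= expectation_indicM eqxx minC; congr (_ + _).
rewrite (eq_bigr (fun=> F s * F t)) => [|i ij]; last first.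
  by rewrite expectation_indicM ifN 1?eq_sym// mulrC.
by rewrite sumr_const cardC1 card_ord mulr_natl.
Qed.

(* For K, L independent Poisson(m x): mu = E F(K/m), G k = E F(min(k,L)/m) and
   Q = E F(min(K,L)/m). *)
Lemma szasz_estimator_moments (m n : nat) (x : R) : 0 <= x -> (0 < n)%N ->
  exists mu (G : nat -> R) Q,
  [/\ [/\ has_mean (m%:R * x) (fun k => F (k%:R / m%:R)) mu,
      forall k, has_mean (m%:R * x)
                  (fun l => F (Num.min (k%:R / m%:R) (l%:R / m%:R))) (G k) &
      has_mean (m%:R * x) G Q],
      fine 'E_P[szasz_estimator X m n x] = mu &
      var P (szasz_estimator X m n x) = n%:R^-1 * (Q - mu ^+ 2)].
Proof.
move=> x0 n0; set lam := m%:R * x; have lam0 : 0 <= lam by rewrite mulr_ge0.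
pose S := szasz_estimator X m n x.
have uE k := unit_mfun_empirical_cdf n (k%:R / m%:R).
have [uS hS hES] : [/\ unit_mfun S,
    forall w, has_mean lam (fun k => empirical_cdf X n (k%:R / m%:R) w) (S w) &
    has_mean lam (fun k => fine 'E_P[empirical_cdf X n (k%:R / m%:R)])
      (fine 'E_P[S])].
  exact: expectation_pois_series.
have uSE k := unit_mfunM uS (uE k).
have uEE k l := unit_mfunM (uE k) (uE l).
(* Expanding one factor S of S^2, and then the other in [hEES], turns E S^2 into an iterated Poisson
   mean of mixed second moments. *)
have [_ _] := expectation_pois_series P lam0 uSE.
rewrite (_ : (fun w => limn _) = (fun w => S w * S w)); last first.
  by apply/funext => w; have [] := has_meanZ (S w) (hS w).
move=> hESS.
have hEES k : has_mean lam (fun l => fine 'E_P[fun w =>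
      empirical_cdf X n (k%:R / m%:R) w * empirical_cdf X n (l%:R / m%:R) w])
    (fine 'E_P[fun w => S w * empirical_cdf X n (k%:R / m%:R) w]).
  have [_ _] := expectation_pois_series P lam0 (uEE k).
  rewrite (_ : (fun w => limn _) =
      (fun w => S w * empirical_cdf X n (k%:R / m%:R) w)) //.
  apply/funext => w; rewrite (mulrC (S w)).
  by have [] := has_meanZ (empirical_cdf X n (k%:R / m%:R) w) (hS w).
have n0R : n%:R != 0 :> R by rewrite pnatr_eq0 -lt0n.
set mu := fine 'E_P[S] in hES *.
have hmu : has_mean lam (fun k => F (k%:R / m%:R)) mu.
  by apply: has_mean_ext hES => k; exact: expectation_empirical_cdf.
(* The witnesses come from solving [expectation_empirical_cdfM] for the F (min s t) term and taking
   means in l, then in k. *)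
exists mu, (fun k => n%:R * (fine 'E_P[fun w => S w * empirical_cdf X n (k%:R / m%:R) w] -
    (1 - n%:R^-1) * (F (k%:R / m%:R) * mu))),
  (n%:R * (fine 'E_P[fun w => S w * S w] - (1 - n%:R^-1) * (mu * mu))).
split=> //; last by rewrite var_unit_mfun// -/S -/mu; field.
split=> // [k|].
  apply: has_mean_ext (has_meanZ n%:R
    (has_meanB (hEES k) (has_meanZ (1 - n%:R^-1)
      (has_meanZ (F (k%:R / m%:R)) hmu)))) => l.
  by rewrite expectation_empirical_cdfM//; field.
apply: has_meanZ; apply: has_meanB => //; apply: has_meanZ.
by apply: has_mean_ext (has_meanZ mu hmu) => k; rewrite mulrC.
Qed.

End szasz_moments.

(** * Wallis integrals *)

Section wallis.
Context {R : realType}.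
Local Notation mu := (@lebesgue_measure R).
Implicit Types n : nat.

Definition wallis n : R := \int[mu]_(t in `[0, pi / 2]) (sin t ^+ n).

Let pi2_gt0 : 0 < pi / 2 :> R.
Proof. by rewrite divr_gt0// pi_gt0. Qed.

Let continuous_sinX n : continuous (fun t : R => sin t ^+ n).
Proof.
by move=> t; apply: (@continuous_comp _ _ _ sin (fun y => y ^+ n));
  [exact: continuous_sin|exact: exprn_continuous].
Qed.

Let continuous_integrable (f : R -> R) : continuous f ->
  mu.-integrable `[0, pi / 2] (EFin \o f).
Proof.
move=> cf; apply: continuous_compact_integrable; first exact: segment_compact.
by apply: continuous_subspaceT => t; exact: cf.
Qed.

Let integrable_sinX n :
  mu.-integrable `[0, pi / 2] (EFin \o (fun t : R => sin t ^+ n)).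
Proof. exact/continuous_integrable/continuous_sinX. Qed.

Lemma wallis0 : wallis 0 = pi / 2.
Proof.
rewrite /wallis; under eq_Rintegral do rewrite expr0.
rewrite Rintegral_cst//= mul1r lebesgue_measure_itv/= lte_fin pi2_gt0.
by rewrite -EFinB/= subr0.
Qed.

Let Rintegral_FTC (f G : R -> R) : continuous f ->
  (forall t : R, is_derive t 1 G (f t)) ->
  \int[mu]_(t in `[0, pi / 2]) f t = G (pi / 2) - G 0.
Proof.
move=> cf dG; rewrite /Rintegral (@continuous_FTC2 _ f G)//.
- by apply: continuous_subspaceT => t; exact: cf.
- have cG t : {for t, continuous G}.
    by apply/differentiable_continuous/derivable1_diffP; case: (dG t).
  split => [t _||]; first by case: (dG t).
  + exact/cvg_at_right_filter/cG.
  + exact/cvg_at_left_filter/cG.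
- by move=> t _; rewrite derive1E; case: (dG t).
Qed.

Lemma wallis1 : wallis 1 = 1.
Proof.
have d (t : R) : is_derive t 1 (fun t => - cos t) (sin t ^+ 1).
  by apply: is_derive_eq; rewrite expr1; ring.
by rewrite /wallis (Rintegral_FTC (@continuous_sinX 1) d) cos_pihalf cos0; ring.
Qed.

(** The difference of the two integrands has the antiderivative -cos t * sin t ^ (n + 1), which
    vanishes at 0 and at pi / 2. *)
Lemma wallis_rec n : n.+2%:R * wallis n.+2 = n.+1%:R * wallis n.
Proof.
have d (t : R) : is_derive t 1 (fun t => - cos t * sin t ^+ n.+1)
    (n.+2%:R * sin t ^+ n.+2 - n.+1%:R * sin t ^+ n).
  have -> : (fun t : R => - cos t * sin t ^+ n.+1) = (- cos) * (sin ^+ n.+1).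
    by apply/funext => y; rewrite /= exprfctE.
  apply: is_derive_eq; rewrite /GRing.scale/= exprfctE.
  apply/eqP; rewrite -subr_eq0.
  rewrite -[(- cos) t]/(- cos t) -[n.+2%:R]natr1 !exprS [X in X == 0](_ : _ =
    n.+1%:R * sin t ^+ n * (1 - (cos t ^+ 2 + sin t ^+ 2))); last by ring.
  by rewrite cos2Dsin2 subrr mulr0.
have c : continuous (fun t : R => n.+2%:R * sin t ^+ n.+2 - n.+1%:R * sin t ^+ n).
  by move=> y; apply: cvgB; apply: cvgM; do ?exact: cvg_cst; exact: continuous_sinX.
have Z k (r : R) : r * wallis k = \int[mu]_(t in `[0, pi / 2]) (r * sin t ^+ k).
  by rewrite RintegralZl.
have I k (r : R) : mu.-integrable `[0, pi / 2] (EFin \o (fun t : R => r * sin t ^+ k)).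
  apply: continuous_integrable => y.
  by apply: cvgM; [exact: cvg_cst|exact: continuous_sinX].
apply/eqP; rewrite -subr_eq0; apply/eqP.
rewrite !Z -RintegralB//.
by rewrite (Rintegral_FTC c d) cos_pihalf sin0 expr0n/=; ring.
Qed.

Lemma wallis_gt0 n : 0 < wallis n.
Proof.
(* Two consecutive values are carried along because the recurrence advances by two. *)
have h k : (0 < wallis k) && (0 < wallis k.+1).
  elim: k => [|k /andP[ih0 ih1]]; first by rewrite wallis0 wallis1 pi2_gt0 ltr01.
  rewrite ih1/= -(@pmulr_rgt0 _ k.+2%:R)// wallis_rec.
  by rewrite mulr_gt0.
by case/andP: (h n).
Qed.

Lemma wallis_decr n : wallis n.+1 <= wallis n.
Proof.
rewrite /wallis; apply: (le_Rintegral _ (integrable_sinX _) (integrable_sinX _)) => // t.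
rewrite /= in_itv/= => /andP[t0 tpi].
rewrite exprS ler_piMl ?sin_le1// exprn_ge0//.
apply: sin_ge0_pi; rewrite t0/= (le_trans tpi)//.
by rewrite ler_pdivrMr// ler_peMr ?pi_ge0// ler1n.
Qed.

(** By the recurrence this product does not depend on n; its value is read off at n = 0. *)
Lemma wallis_mul n : n.+1%:R * (wallis n * wallis n.+1) = pi / 2.
Proof.
elim: n => [|n <-]; first by rewrite wallis0 wallis1; ring.
by rewrite mulrCA wallis_rec; ring.
Qed.

(** Monotonicity replaces the product in [wallis_mul] by a square. With the next lemma this gives
    Wallis' asymptotics with explicit bounds valid for every n. *)
Lemma wallis_sqr_ge n : pi / 2 <= n.+1%:R * wallis n ^+ 2.
Proof.
rewrite -(wallis_mul n) ler_pM2l// expr2 ler_pM2l ?wallis_gt0//.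
exact: wallis_decr.
Qed.

Lemma wallis_sqr_le n : n%:R * wallis n ^+ 2 <= pi / 2.
Proof.
case: n => [|n]; first by rewrite mul0r ltW.
rewrite -(wallis_mul n) ler_pM2l// expr2 ler_pM2r ?wallis_gt0//.
exact: wallis_decr.
Qed.

End wallis.

(** * Mean distance of the simple random walk *)

Section random_walk.
Context {R : realType}.
Implicit Types n N k : nat.

(** Pascal's rule; for the walk, conditioning on a single step. *)
Lemma sum_binS n (g : nat -> R) :
  \sum_(k < n.+2) 'C(n.+1, k)%:R * g k =
  \sum_(k < n.+1) 'C(n, k)%:R * (g k + g k.+1).
Proof.
rewrite big_ord_recl bin0.
under eq_bigr do rewrite lift0 binS natrD mulrDl.
under [RHS]eq_bigr do rewrite mulrDr.
rewrite !big_split/= addrA; congr (_ + _).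
rewrite big_ord_recr/= bin_small// mul0r addr0.
by rewrite [RHS]big_ord_recl bin0.
Qed.

(* [walk_abs N] is the mean distance from the origin of the simple random walk
   after N steps, k of which go up. *)
Definition walk_abs N : R :=
  (2 ^+ N)^-1 * \sum_(k < N.+1) 'C(N, k)%:R * `|k%:R - (N - k)%N%:R|.

(** The probability that the walk is at the origin after 2n steps. *)
Definition walk_return n : R := 'C(n.*2, n)%:R / 4 ^+ n.

(** At position s = 2k - N the mean distance after one more step is (|s - 1| + |s + 1|) / 2, which
    is |s|, plus 1 if s = 0. So the increment is the probability of being at the origin. *)
Lemma walk_absS N :
  walk_abs N.+1 = walk_abs N +
    (2 ^+ N)^-1 * \sum_(k < N.+1) 'C(N, k)%:R * (k.*2 == N)%:R.
Proof.
have E k : (k <= N)%N -> `|k%:R - (N - k)%N%:R| = `|2 * k%:R - N%:R| :> R.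
  by move=> kN; rewrite natrB//; congr `|_|; ring.
have E1 : walk_abs N.+1 = (2 ^+ N.+1)^-1 *
    \sum_(k < N.+2) 'C(N.+1, k)%:R * `|2 * k%:R - N.+1%:R|.
  congr (_ * _); apply: eq_bigr => k _.
  by rewrite natrB 1?leq_ord// ; congr (_ * `|_|); ring.
rewrite E1 (sum_binS _ (fun k => `|2 * k%:R - N.+1%:R|)) /walk_abs -mulrDr exprS.
rewrite invfM (mulrC 2^-1) -mulrA; congr (_ * _).
rewrite -big_split mulr_sumr; apply: eq_bigr => k _ /=.
rewrite -mulrDr mulrCA; congr (_ * _); rewrite E ?leq_ord//.
apply: (@mulfI _ 2) => //; rewrite mulVKf//.
have -> : (k.*2 == N)%:R = (2 * k%:R == N%:R :> R)%:R :> R.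
  by rewrite -natrM eqr_nat mul2n.
rewrite -[k.+1%:R]natr1 -[N.+1%:R]natr1 mulrDr mulr1.
have [->|kN] := eqVneq (2 * k%:R) (N%:R : R).
  by rewrite subrr normr0 ler0_norm ?ger0_norm ?mulr1n; lra.
have : k.*2 != N by rewrite -(eqr_nat R) -mul2n natrM.
rewrite neq_ltn => /orP[]; rewrite -(ler_nat R) -natr1 -mul2n natrM => h.
  by rewrite !ler0_norm ?mulr0n; lra.
by rewrite !ger0_norm ?mulr0n; lra.
Qed.

Lemma walk_abs0 : walk_abs 0 = 0.
Proof.
by rewrite /walk_abs big_ord_recl big_ord0 subrr normr0 mulr0 addr0 mulr0.
Qed.

Lemma walk_abs_odd n : walk_abs n.*2.+1 = walk_abs n.*2 + walk_return n.
Proof.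
rewrite walk_absS; congr (_ + _).
have nn : (n < n.*2.+1)%N by rewrite ltnS -addnn leq_addr.
rewrite (bigD1 (Ordinal nn))//= eqxx mulr1 big1 => [|k kn]; last first.
  by move: kn; rewrite (inj_eq double_inj) -val_eqE/= => /negbTE->; rewrite mulr0.
by rewrite addr0 mulrC /walk_return -muln2 mulnC exprM -natrX.
Qed.

(** After an odd number of steps the walk is not at the origin, so the increment is zero. *)
Lemma walk_abs_even n : walk_abs n.+1.*2 = walk_abs n.*2.+1.
Proof.
rewrite doubleS walk_absS big1 ?mulr0 ?addr0// => k _.
suff -> : (k.*2 == n.*2.+1) = false by rewrite mulr0.
by apply/negP => /eqP /(congr1 odd); rewrite /= !odd_double.
Qed.

Lemma walk_returnS n :
  2 * n.+1%:R * walk_return n.+1 = n.*2.+1%:R * walk_return n.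
Proof.
rewrite /walk_return exprS.
have h : (n.+1 * 'C(n.+1.*2, n.+1) = 2 * (n.*2.+1 * 'C(n.*2, n)))%N.
  rewrite doubleS -mul_bin_diag [X in (_ = 2 * X)%N](mul_bin_down n.*2.+1 n).
  have -> : (n.*2.+1 - n = n.+1)%N by rewrite -addnn -addSn addnK.
  by rewrite mulnA mul2n doubleS.
have {}h := congr1 (fun k => k%:R : R) h; rewrite !natrM in h.
have -> : 2 * n.+1%:R * ('C(n.+1.*2, n.+1)%:R / (4 * 4 ^+ n)) =
  n.+1%:R * 'C(n.+1.*2, n.+1)%:R * (2^-1 / 4 ^+ n) :> R by field.
by rewrite h; field.
Qed.

(** The left side is the sum of the return probabilities up to n, and [walk_returnS] makes it
    telescope. *)
Lemma walk_abs_oddE n : walk_abs n.*2.+1 = n.*2.+1%:R * walk_return n.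
Proof.
elim: n => [|n ih].
  by rewrite walk_abs_odd walk_abs0 add0r mul1r.
rewrite walk_abs_odd walk_abs_even ih -walk_returnS.
by rewrite -[_.*2.+1 in RHS]addn1 natrD -mul2n natrM; ring.
Qed.

(** From n to n + 1 the first factor is multiplied by (2n + 3) / (2n + 2) and the second by its
    inverse. *)
Lemma walk_abs_wallis n : walk_abs n.*2.+1 * wallis n.*2.+1 = 1.
Proof.
elim: n => [|n ih].
  by rewrite walk_abs_oddE wallis1 /walk_return bin0 expr0 divr1 !mulr1.
have a0 : n.*2.+3%:R != 0 :> R by rewrite pnatr_eq0.
have b0 : n.*2.+2%:R != 0 :> R by rewrite pnatr_eq0.
have w : n.*2.+3%:R * wallis n.*2.+3 = n.*2.+2%:R * wallis n.*2.+1 :> R.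
  exact: wallis_rec.
have r : n.*2.+2%:R * walk_return n.+1 = n.*2.+1%:R * walk_return n.
  by rewrite -walk_returnS -natrM mul2n.
by rewrite walk_abs_oddE doubleS mulrAC w -[RHS]ih walk_abs_oddE -r; ring.
Qed.

Lemma walk_abs_sqr N : `|walk_abs N ^+ 2 - 2 * N%:R / pi| <= 2 / pi.
Proof.
have pi0 := @pi_gt0 R.
have odd_le n : 2 * n.*2.+1%:R / pi <= walk_abs n.*2.+1 ^+ 2 <= 2 * n.*2.+2%:R / pi.
  have w := walk_abs_wallis n; set W := wallis n.*2.+1 in w.
  have W0 : 0 < W := wallis_gt0 _.
  have -> : walk_abs n.*2.+1 = W^-1.
    by apply: (mulIf (lt0r_neq0 W0)); rewrite w mulVf// lt0r_neq0.
  have := wallis_sqr_ge (R := R) n.*2.+1; have := wallis_sqr_le (R := R) n.*2.+1.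
  rewrite -/W => le1 le2; rewrite exprVn; apply/andP; split.
    rewrite ler_pdivrMr// (mulrC _ pi) ler_pdivlMr ?exprn_gt0//.
    by rewrite ler_pdivlMr// in le1; rewrite -mulrA (mulrC 2).
  rewrite ler_pdivlMr// (mulrC _ pi) ler_pdivrMr ?exprn_gt0//.
  by rewrite ler_pdivrMr// in le2; rewrite -mulrA (mulrC 2).
have scale k : 2 * k.+1%:R / pi = 2 * k%:R / pi + 2 / pi :> R.
  by rewrite -natr1; ring.
have p0 : 0 <= 2 / pi :> R by rewrite divr_ge0// ltW.
rewrite ler_distl.
(* Odd N gives a square between 2 N / pi and 2 (N + 1) / pi. Even N > 0 inherits the value at N - 1,
   hence 2 (N - 1) / pi and 2 N / pi. *)
case: (odd_double_half N) => <-; case: (odd N) => /=; rewrite ?add1n ?add0n.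
  by have := odd_le N./2; rewrite scale; lra.
case: N./2 => [|k].
  by rewrite walk_abs0 expr0n mulr0 mul0r/=; lra.
by have := odd_le k; rewrite walk_abs_even doubleS !scale; lra.
Qed.

End random_walk.

(** * Convolution of Poisson means *)

(** Both sides become unordered sums [esum], matched by the bijection (N, k) to (k, N - k) from the
    pairs with k <= N. *)
Lemma nneseries_antidiagonal {R : realType} (a : nat -> nat -> \bar R) :
  (forall k l, 0 <= a k l)%E ->
  (\sum_(k <oo) \sum_(l <oo) a k l =
   \sum_(N <oo) \sum_(k < N.+1) a k (N - k)%N)%E.
Proof.
move=> a0.
rewrite [LHS]nneseries_esumT; last first.
  by move=> k; apply: nneseries_ge0 => l _ _; exact: a0.
under [LHS]eq_esum do rewrite nneseries_esumT//.
rewrite esum_esum//.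
rewrite [RHS]nneseries_esumT; last by move=> N; apply: sume_ge0.
under [RHS]eq_esum => N _.
  rewrite (fsbig_ord _ _ (fun k => a k (N - k)%N)) -esum_fset//.
  over.
rewrite [RHS]esum_esum//.
rewrite (@reindex_esum _ _ _ ([set: nat] `*`` (fun N => `I_N.+1)) _
  (fun Nk => (Nk.2, (Nk.1 - Nk.2)%N)))//.
split=> [[N k]//|[N k] [N' k']|[k l] _ /=].
  move=> /set_mem[_ /= kN] /set_mem[_ /= kN'] [kk]; rewrite -kk in kN' * => e.
  by rewrite -(subnK (kN : (k <= N)%N)) e subnK.
exists ((k + l)%N, k) => /=; last by rewrite addKn.
by split=> //; rewrite ltnS leq_addr.
Qed.

Lemma pois_convolution {R : realType} (lam : R) k l :
  (2 ^+ (k + l))^-1 * 'C(k + l, k)%:R * pois (2 * lam) (k + l) =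
  pois lam k * pois lam l.
Proof.
have h := congr1 (fun i => i%:R : R) (bin_fact (leq_addr l k)).
rewrite addKn !natrM in h.
have f0 i : i`!%:R != 0 :> R by rewrite pnatr_eq0 -lt0n fact_gt0.
have c0 : 'C(k + l, k)%:R != 0 :> R by rewrite pnatr_eq0 -lt0n bin_gt0 leq_addr.
have t0 : 2 ^+ (k + l) != 0 :> R by rewrite expf_neq0.
have e : - (2 * lam) = - lam - lam by ring.
rewrite /pois -h exprMn (exprD lam) e expRD.
by field; rewrite t0 c0 !f0.
Qed.

(* If K, L are independent Poisson(lam), then K + L is Poisson(2 lam) and K is
   binomial(N, 1/2) given K + L = N. *)
Lemma has_mean_convolution {R : realType} (lam s : R) (g : nat -> nat -> R)
    (M : nat -> R) :
  0 <= lam -> (forall k l, 0 <= g k l) ->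
  (forall k, has_mean lam (g k) (M k)) -> has_mean lam M s ->
  has_mean (2 * lam)
    (fun N => (2 ^+ N)^-1 * \sum_(k < N.+1) 'C(N, k)%:R * g k (N - k)%N) s.
Proof.
move=> l0 g0 hg hM; apply/has_meanP; apply: cvg_series_nneseries => [N|].
  rewrite mulr_ge0 ?pois_ge0 ?mulr_ge0 ?invr_ge0 ?exprn_ge0//.
  by apply: sumr_ge0 => k _; rewrite mulr_ge0.
rewrite -(nneseries_cvg_series (iffLR (has_meanP _ _ _) hM)).
transitivity (\sum_(k <oo) \sum_(l <oo)
    (g k l * (pois lam k * pois lam l))%:E)%E; last first.
  apply: eq_eseriesr => k _; apply: nneseries_cvg_series.
  rewrite [X in series X](_ : _ = (pois lam k) *: (fun l => g k l * pois lam l)).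
    rewrite seriesZ [M k * _]mulrC; apply: cvgZr; exact/has_meanP.
  by apply/funext => l; rewrite mulrCA.
rewrite nneseries_antidiagonal => [|k l]; last first.
  by rewrite lee_fin; apply: mulr_ge0 => //; apply: mulr_ge0; exact: pois_ge0.
apply: eq_eseriesr => N _; rewrite sumEFin; congr (_%:E).
rewrite mulr_sumr mulr_suml; apply: eq_bigr => k _.
have kN : (k <= N)%N := leq_ord k.
by rewrite -pois_convolution subnKC//; ring.
Qed.

(** * Asymptotics of Poisson means *)

Section poisson_asymptotics.
Context {R : realType}.
Implicit Types (lam s t u x : R) (m k l : nat).

(** Every asymptotic estimate below is a pointwise bound passed to Poisson means in this way. *)
Lemma has_mean_approx lam (a b c : nat -> R) s t u : 0 <= lam ->
  (forall k, `|a k - b k| <= c k) ->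
  has_mean lam a s -> has_mean lam b t -> has_mean lam c u -> `|s - t| <= u.
Proof.
move=> l0 abc ha hb hc.
have [v hv vu] := has_mean_dominated l0 abc hc.
by rewrite (has_mean_unique (has_meanB ha hb) hv).
Qed.

Lemma has_mean_abs_diff lam : 0 <= lam -> exists M s,
  (forall k, has_mean lam (fun l => `|k%:R - l%:R|) (M k)) /\ has_mean lam M s.
Proof.
move=> l0.
(* The bound |k - l| <= k + l gives the inner mean, and its bound k + lam then dominates the outer
   one. *)
have hM k : exists2 M, has_mean lam (fun l => `|k%:R - l%:R|) M & `|M| <= k%:R + lam.
  apply: has_mean_dominated l0 _ (has_meanD (has_mean_cst lam k%:R) (has_mean_id lam)).
  by move=> l; rewrite normr_id (le_trans (ler_normB _ _))// !ger0_norm.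
have [M hM1] : exists M : nat -> R, forall k,
    has_mean lam (fun l => `|k%:R - l%:R|) (M k) /\ `|M k| <= k%:R + lam.
  exists (fun k => sval (cid2 (hM k))) => k.
  by split; case: (cid2 (hM k)).
have [s hs _] := has_mean_dominated l0 (fun k => (hM1 k).2)
  (has_meanD (has_mean_id lam) (has_mean_cst lam lam)).
by exists M, s; split => // k; case: (hM1 k).
Qed.

Lemma walk_abs_ge0 N : 0 <= walk_abs N :> R.
Proof.
rewrite mulr_ge0 ?invr_ge0 ?exprn_ge0//.
by apply: sumr_ge0 => k _; rewrite mulr_ge0.
Qed.

(** With c^2 = 2 lam / pi and e the walk mean, |e - c| <= |e^2 - c^2| / c, and [walk_abs_sqr] leaves
    a multiple of 1 + |N - lam|. AM-GM makes this quadratic in N, so that its Poisson mean is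
    explicit; the scale sqrt lam is the standard deviation. *)
Lemma walk_abs_approx lam N : 0 < lam ->
  `|walk_abs N - Num.sqrt (2 * lam / pi)| <=
    2 / pi / Num.sqrt (2 * lam / pi) * (1 + ((N%:R - lam) ^+ 2 / Num.sqrt lam + Num.sqrt lam) / 2).
Proof.
move=> l0; set c := Num.sqrt (2 * lam / pi).
have p0 := @pi_gt0 R.
have c0 : 0 < c by rewrite sqrtr_gt0 divr_gt0// mulr_gt0.
have cc : c ^+ 2 = 2 * lam / pi by rewrite sqr_sqrtr// ltW// divr_gt0// mulr_gt0.
set q := Num.sqrt lam; have q0 : 0 < q by rewrite sqrtr_gt0.
have qq : q ^+ 2 = lam by rewrite sqr_sqrtr// ltW.
have e0 := walk_abs_ge0 N.
(* AM-GM: [2 |y| <= y^2 / q + q] *)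
have dN : `|N%:R - lam| <= ((N%:R - lam) ^+ 2 / q + q) / 2.
  set y := N%:R - lam; rewrite -(real_normK (num_real y)).
  rewrite -subr_ge0 (_ : _ - _ = (`|y| - q) ^+ 2 / q / 2).
    by rewrite divr_ge0// divr_ge0 ?sqr_ge0// ltW.
  by field; rewrite lt0r_neq0.
rewrite mulrAC ler_pdivlMr//.
apply: (@le_trans _ _ (`|walk_abs N ^+ 2 - c ^+ 2|)).
  rewrite subr_sqr normrM ler_wpM2l//.
  by rewrite ger0_norm ?lerDr// addr_ge0// ltW.
rewrite cc -[X in `|X|](subrKA (2 * N%:R / pi)).
rewrite (le_trans (ler_normD _ _))// mulrDr mulr1 lerD//.
  exact: walk_abs_sqr.
have -> : 2 * N%:R / pi - 2 * lam / pi = 2 / pi * (N%:R - lam) by ring.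
have p2 : 0 <= 2 / pi :> R by rewrite divr_ge0// ltW.
by rewrite normrM (ger0_norm p2) ler_wpM2l.
Qed.

Lemma abs_diff_asymptotics lam (M : nat -> R) s : 1 / 2 <= lam ->
  (forall k, has_mean lam (fun l => `|k%:R - l%:R|) (M k)) -> has_mean lam M s ->
  `|s - 2 * Num.sqrt (lam / pi)| <= 2.
Proof.
move=> l12 hM hs.
have p0 := @pi_gt0 R.
have p2 : 2 <= pi :> R by exact: pi_ge2.
have l0 : 0 < lam by lra.
have l1 : 1 <= 2 * lam by lra.
have ll0 : 0 < 2 * lam by lra.
have hw : has_mean (2 * lam) walk_abs s.
  exact: (has_mean_convolution (g := fun k l => `|k%:R - l%:R|) (ltW l0) _ hM hs).
set c := Num.sqrt (2 * (2 * lam) / pi); set q := Num.sqrt (2 * lam).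
have q1 : 1 <= q by rewrite -sqrtr1 ler_wsqrtr.
have qq : q ^+ 2 = 2 * lam by rewrite sqr_sqrtr// ltW.
have hb : has_mean (2 * lam)
    (fun N => 2 / pi / c * (1 + ((N%:R - 2 * lam) ^+ 2 / q + q) / 2))
    (2 / pi / c * (1 + q)).
  apply/has_meanZ/has_meanD; first exact: has_mean_cst.
  have h := has_meanZ q^-1 (has_mean_sqr (2 * lam)).
  have {}h := has_meanZ 2^-1 (has_meanD h (has_mean_cst _ q)).
  have e : 2^-1 * (q^-1 * (2 * lam) + q) = q by rewrite -qq; field; lra.
  by rewrite e in h; apply: has_mean_ext h => N; rewrite mulrC [q^-1 * _]mulrC.
have := has_mean_approx (ltW ll0) (fun N => walk_abs_approx N ll0) hw
  (has_mean_cst _ _) hb.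
have -> : 2 * Num.sqrt (lam / pi) = c.
  have -> : 2 = Num.sqrt 4 :> R.
    by rewrite (_ : 4 = 2 ^+ 2) ?sqrtr_sqr ?ger0_norm//; ring.
  by rewrite -sqrtrM//; congr Num.sqrt; ring.
move=> /le_trans; apply.
(* After squaring this is 2 <= pi. Together with 1 + q <= 2 q, where lam >= 1 / 2 enters, it bounds
   the error by 2. *)
have qc : 2 / pi * q <= c.
  rewrite -(ger0_norm (x := 2 / pi * q)); last by rewrite !mulr_ge0 ?invr_ge0; lra.
  rewrite -sqrtr_sqr ler_wsqrtr// exprMn qq -subr_ge0.
  have -> : 2 * (2 * lam) / pi - (2 / pi) ^+ 2 * (2 * lam) =
     2 * (2 * lam) / pi ^+ 2 * (pi - 2) by field; lra.
  by rewrite mulr_ge0 ?subr_ge0// divr_ge0 ?sqr_ge0; lra.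
have c0 : 0 < c by rewrite sqrtr_gt0 divr_gt0//; lra.
apply: (@le_trans _ _ (2 / pi / c * (2 * q))).
  apply: ler_wpM2l; last by lra.
  by rewrite !divr_ge0//; lra.
by rewrite mulrAC ler_pdivrMr//; lra.
Qed.


Lemma has_mean_grid_sqr m x : (0 < m)%N ->
  has_mean (m%:R * x) (fun k => (k%:R / m%:R - x) ^+ 2) (x / m%:R).
Proof.
move=> m0; have m0R : m%:R != 0 :> R by rewrite pnatr_eq0 -lt0n.
have h := has_meanZ (m%:R ^- 2) (has_mean_sqr (m%:R * x)).
have e : m%:R ^- 2 * (m%:R * x) = x / m%:R :> R by field.
by rewrite e in h; apply: has_mean_ext h => k; field.
Qed.

Lemma has_mean_grid_pow4 m x : (0 < m)%N ->
  has_mean (m%:R * x) (fun k => (k%:R / m%:R - x) ^+ 4)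
    (x / m%:R ^+ 3 + 3 * x ^+ 2 / m%:R ^+ 2).
Proof.
move=> m0; have m0R : m%:R != 0 :> R by rewrite pnatr_eq0 -lt0n.
have h := has_meanZ (m%:R ^- 4) (has_mean_pow4 (m%:R * x)).
have e : m%:R ^- 4 * (m%:R * x + 3 * (m%:R * x) ^+ 2) =
  x / m%:R ^+ 3 + 3 * x ^+ 2 / m%:R ^+ 2 :> R by field.
by rewrite e in h; apply: has_mean_ext h => k; field.
Qed.

Lemma has_mean_grid m x : (0 < m)%N ->
  has_mean (m%:R * x) (fun k => k%:R / m%:R - x) 0.
Proof.
move=> m0; have m0R : m%:R != 0 :> R by rewrite pnatr_eq0 -lt0n.
have h := has_meanB (has_meanZ m%:R^-1 (has_mean_id (m%:R * x))) (has_mean_cst _ x).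
by rewrite mulKf// subrr in h; apply: has_mean_ext h => k; rewrite mulrC.
Qed.

(** The linear term drops out because K / m has mean x, and the quartic error has mean O(m^-2).
    Taking b = D = 0 gives a crude O(1 / m) bound. *)
Lemma mean_taylor2 (F : R -> R) m x (a b e D mu : R) : (0 < m)%N -> 0 < x ->
  (forall y, 0 <= y ->
    `|F y - (F x + a * (y - x) + b * (y - x) ^+ 2)| <=
      e * (y - x) ^+ 2 + D * (y - x) ^+ 4) ->
  has_mean (m%:R * x) (fun k => F (k%:R / m%:R)) mu ->
  `|mu - (F x + b * (x / m%:R))| <=
    e * (x / m%:R) + D * (x / m%:R ^+ 3 + 3 * x ^+ 2 / m%:R ^+ 2).
Proof.
move=> m0 x0 hF hmu; have l0 : 0 <= m%:R * x by rewrite mulr_ge0// ltW.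
have hb := has_meanD (has_meanD (has_mean_cst _ (F x))
  (has_meanZ a (has_mean_grid x m0))) (has_meanZ b (has_mean_grid_sqr x m0)).
rewrite mulr0 addr0 in hb.
apply: has_mean_approx l0 _ hmu hb (has_meanD (has_meanZ e (has_mean_grid_sqr x m0))
  (has_meanZ D (has_mean_grid_pow4 x m0))) => k.
by apply: hF; rewrite divr_ge0.
Qed.

(** F is linearised at the minimum. The quadratic errors of K / m and L / m contribute C x / m each,
    and the error 2 in E|K - L|, scaled by |a| / (2 m), contributes |a| / m. *)
Lemma mean_min_asymptotics (F : R -> R) m x (a C Q : R) (G : nat -> R) :
  (0 < m)%N -> 0 < x -> 1 / 2 <= m%:R * x -> 0 <= C ->
  (forall y, 0 <= y -> `|F y - (F x + a * (y - x))| <= C * (y - x) ^+ 2) ->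
  (forall k, has_mean (m%:R * x)
               (fun l => F (Num.min (k%:R / m%:R) (l%:R / m%:R))) (G k)) ->
  has_mean (m%:R * x) G Q ->
  `|Q - (F x - a * Num.sqrt (x / pi) / Num.sqrt m%:R)| <=
    (2 * C * x + `|a|) / m%:R.
Proof.
move=> m0 x0 mx C0 hF hG hQ; have l0 : 0 <= m%:R * x by rewrite mulr_ge0// ltW.
have m0R : m%:R != 0 :> R by rewrite pnatr_eq0 -lt0n.
have m1 : 0 < m%:R :> R by rewrite ltr0n.
have [M [A [hM hA]]] := has_mean_abs_diff l0.
have Gk k : `|G k - (F x + a / 2 * (k%:R / m%:R - x) - a / (2 * m%:R) * M k)| <=
    C * ((k%:R / m%:R - x) ^+ 2 + x / m%:R).
  pose b l := F x + a / 2 * (k%:R / m%:R - x) + a / 2 * (l%:R / m%:R - x) -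
    a / (2 * m%:R) * `|k%:R - l%:R|.
  have hb : has_mean (m%:R * x) b
      (F x + a / 2 * (k%:R / m%:R - x) - a / (2 * m%:R) * M k).
    apply: has_meanB; last exact: has_meanZ.
    have h := has_meanD (has_mean_cst _ (F x + a / 2 * (k%:R / m%:R - x)))
      (has_meanZ (a / 2) (has_mean_grid x m0)).
    by rewrite mulr0 addr0 in h.
  apply: has_mean_approx l0 _ (hG k) hb (has_meanZ C
    (has_meanD (has_mean_cst _ ((k%:R / m%:R - x) ^+ 2)) (has_mean_grid_sqr x m0))).
  move=> l; set y := Num.min _ _.
  (* This is min(u, v) = (u + v - |u - v|) / 2; below, (y - x)^2 is at most the sum of the squares
     for u and v. *)
  have yE : b l = F x + a * (y - x).
    rewrite /b /y minr_absE -mulrBl normrM normfV (ger0_norm (ltW m1)).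
    by field.
  have y0 : 0 <= y by rewrite le_min !divr_ge0.
  rewrite yE (le_trans (hF y y0))// ler_wpM2l//.
  rewrite /y minEle; case: ifP => _; [rewrite lerDl|rewrite lerDr]; exact: sqr_ge0.
have hR : has_mean (m%:R * x)
    (fun k => F x + a / 2 * (k%:R / m%:R - x) - a / (2 * m%:R) * M k)
    (F x - a / (2 * m%:R) * A).
  apply: has_meanB; last exact: has_meanZ.
  have h := has_meanD (has_mean_cst _ (F x)) (has_meanZ (a / 2) (has_mean_grid x m0)).
  by rewrite mulr0 addr0 in h.
have QA := has_mean_approx l0 Gk hQ hR (has_meanZ C
    (has_meanD (has_mean_grid_sqr x m0) (has_mean_cst _ (x / m%:R)))).
have AA := abs_diff_asymptotics mx hM hA.
have sE : Num.sqrt (m%:R * x / pi) / m%:R = Num.sqrt (x / pi) / Num.sqrt m%:R.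
  rewrite -mulrA sqrtrM// -{2}(sqr_sqrtr (ltW m1)).
  by field; rewrite lt0r_neq0// sqrtr_gt0.
have -> : Q - (F x - a * Num.sqrt (x / pi) / Num.sqrt m%:R) =
    Q - (F x - a / (2 * m%:R) * A) -
    a / (2 * m%:R) * (A - 2 * Num.sqrt (m%:R * x / pi)).
  rewrite -[a * _ / _]mulrA -sE; field.
  done.
apply: le_trans (ler_normB _ _) _.
rewrite [X in _ <= X]mulrDl; apply: lerD.
  by apply: le_trans QA _; rewrite le_eqVlt; apply/orP; left; apply/eqP; ring.
rewrite normrM normf_div (gtr0_norm (_ : 0 < 2 * m%:R)) ?mulr_gt0//.
apply: (@le_trans _ _ (`|a| / (2 * m%:R) * 2)).
  by rewrite ler_wpM2l// divr_ge0// mulr_ge0// ltW.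
by rewrite le_eqVlt; apply/orP; left; apply/eqP; field.
Qed.

End poisson_asymptotics.

(** * Taylor bounds *)

Section taylor.
Context {R : realType}.
Implicit Types (g : R -> R) (x y e : R).

(** The radius is kept at most x, so that y stays in the half-line on which the difference quotient
    is controlled. *)
Lemma has_derivative_on_estimate g (g' : R -> R) x e :
  has_derivative_on `[0, +oo[ g g' -> 0 < x -> 0 < e ->
  exists2 r, 0 < r <= x & forall y, `|y - x| < r ->
    `|g y - g x - g' x * (y - x)| <= e * `|y - x|.
Proof.
move=> dg x0 e0.
have x0D : `[0, +oo[%classic x by rewrite /= in_itv/= andbT ltW.
have /cvgrPdist_le/(_ _ e0) := dg x x0D.
move=> /nbhs_ballP[r /= r0 hr].
exists (Num.min r x); first by rewrite lt_min r0 x0 ge_min lexx orbT.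
move=> y; rewrite lt_min => /andP[yr yx].
have [->|yNx] := eqVneq y x; first by rewrite !subrr mulr0 subrr normr0 mulr0.
have yx0 : y - x != 0 by rewrite subr_eq0.
have y0 : `[0, +oo[%classic y.
  by rewrite /= in_itv/= andbT; move: yx; rewrite ltr_norml; lra.
have := hr y _ yNx y0; rewrite /ball/= distrC => /(_ yr) q_le.
rewrite [X in `|X|](_ : _ = - (g' x - (g y - g x) / (y - x)) * (y - x)); last by field.
by rewrite normrM normrN ler_wpM2r.
Qed.

Lemma has_derivative_on_is_derive g (g' : R -> R) x :
  has_derivative_on `[0, +oo[ g g' -> 0 < x -> is_derive x 1 g (g' x).
Proof.
move=> dg x0.
have h : (fun h => h^-1 *: ((g \o shift x) (h *: 1) - g x)) @ 0^' --> g' x.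
  apply/cvgrPdist_le => e e0.
  have [r /andP[r0 _] hr] := has_derivative_on_estimate dg x0 e0.
  apply/nbhs_ballP; exists r => //= y; rewrite /ball/= sub0r normrN => yr y0.
  rewrite /GRing.scale/= mulr1.
  have := hr (y + x); rewrite addrK => /(_ yr) q_le.
  rewrite -(ler_pM2r (_ : 0 < `|y|)) ?normr_gt0// -normrM -normrN.
  by rewrite [X in `|X|](_ : _ = g (y + x) - g x - g' x * y)//; field.
by split; [exact: cvgP h|exact: cvg_lim h].
Qed.

(** Peano's remainder: the mean value theorem is applied to F minus its quadratic part, whose
    derivative f z - f x - f' x (z - x) is small by differentiability of f at x. *)
Lemma taylor2_near (F f f' : R -> R) x e : continuous F ->
  has_derivative_on `[0, +oo[ F f -> has_derivative_on `[0, +oo[ f f' ->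
  0 < x -> 0 < e ->
  exists2 r, 0 < r & forall y, `|y - x| < r ->
    `|F y - (F x + f x * (y - x) + f' x / 2 * (y - x) ^+ 2)| <= e * (y - x) ^+ 2.
Proof.
move=> cF dF df x0 e0.
have [r /andP[r0 rx] hr] := has_derivative_on_estimate df x0 e0.
exists r => // y yr.
pose h z := F z - (f x * (z - x) + f' x / 2 * (z - x) ^+ 2).
pose dh z := f z - f x - f' x * (z - x).
have ch : continuous h.
  move=> z; apply: cvgB; first exact: cF.
  have cz : (fun z => z - x) @ z --> z - x by apply: cvgB; [exact: cvg_id|exact: cvg_cst].
  apply: cvgD; first by apply: cvgM => //; exact: cvg_cst.
  by apply: cvgM; [exact: cvg_cst|exact: cvgM].
have dhE (z : R) : 0 < z -> is_derive z 1 h (dh z).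
  move=> z0; have dFz := has_derivative_on_is_derive dF z0.
  have dx : is_derive z 1 (fun z => z - x) (1 - 0).
    exact: is_deriveB (is_derive_id z 1) (is_derive_cst x z 1).
  have dq := is_deriveD (is_deriveZ (f x) dx) (is_deriveZ (f' x / 2) (is_deriveX 2 dx)).
  have dhz := is_deriveB dFz dq.
  have -> : dh z = f z - (f x *: (1 - 0) +
      (f' x / 2) *: ((2%:R * (z - x) ^+ 2.-1) *: (1 - 0))).
    rewrite /dh /GRing.scale/= expr1 !subr0 !mulr1.
    by rewrite (mulrA (f' x / 2)) divfK// opprD addrA.
  exact: dhz.
rewrite [X in `|X|](_ : _ = h y - h x); last by rewrite /h; ring.
have y0 : 0 < y by move: yr; rewrite ltr_norml; lra.
suff [c c_le hc] : exists2 c, `|c - x| <= `|y - x| & h y - h x = dh c * (y - x).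
  rewrite hc normrM (le_trans (ler_wpM2r (normr_ge0 _) (hr c (le_lt_trans c_le yr))))//.
  rewrite -[X in _ <= _ * X]real_normK ?num_real// expr2 mulrA ler_wpM2r// ler_wpM2l//.
  exact: ltW.
have [yx|xy|->] := ltgtP y x; last by exists x; rewrite // !subrr mulr0.
  have [|c cxy hc] := @MVT _ h dh _ _ yx _ (continuous_subspaceT ch).
    by move=> z; rewrite in_itv/= => /andP[yz _]; apply: dhE; lra.
  exists c; last by rewrite -opprB hc; ring.
  move: cxy; rewrite in_itv/= => cxy.
  by rewrite !ler0_norm; lra.
have [|c cxy hc] := @MVT _ h dh _ _ xy _ (continuous_subspaceT ch).
  by move=> z; rewrite in_itv/= => /andP[yz _]; apply: dhE; lra.
exists c => //; move: cxy; rewrite in_itv/= => cxy.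
by rewrite !ger0_norm; lra.
Qed.

(** Away from the expansion point a higher power absorbs the lower ones. *)
Lemma pow_ge_far (r t : R) (i j : nat) : 0 < r -> r <= t -> (i <= j)%N ->
  t ^+ i <= r ^- (j - i) * t ^+ j.
Proof.
move=> r0 rt ij; have t0 : 0 < t := lt_le_trans r0 rt.
rewrite -{2}(subnK ij) exprD mulrA ler_peMl ?exprn_ge0 ?(ltW t0)//.
by rewrite -exprVn -exprMn exprn_ege1// mulrC ler_pdivlMr// mul1r.
Qed.

Variables (F f f' : R -> R) (x : R).
Hypothesis F01 : forall y, 0 <= F y <= 1.
Hypothesis cF : continuous F.
Hypothesis dF : has_derivative_on `[0, +oo[ F f.
Hypothesis df : has_derivative_on `[0, +oo[ f f'.
Hypothesis x0 : 0 < x.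

Let F_dist y : `|F y - F x| <= 1.
Proof. by have := F01 y; have := F01 x; rewrite ler_norml; lra. Qed.

(** Near x this is [taylor2_near]. At distance at least r, the increment of F (at most 1), the
    linear and the quadratic term are each absorbed into the fourth power, which gives the three
    summands of D. *)
Lemma taylor2_global e : 0 < e -> exists2 D, 0 <= D & forall y,
  `|F y - (F x + f x * (y - x) + f' x / 2 * (y - x) ^+ 2)| <=
    e * (y - x) ^+ 2 + D * (y - x) ^+ 4.
Proof.
move=> e0; have [r r0 near_x] := taylor2_near cF dF df x0 e0.
pose D := r ^- 4 + `|f x| * r ^- 3 + `|f' x / 2| * r ^- 2.
have r_ge0 i : 0 <= r ^- i by rewrite invr_ge0 exprn_ge0// ltW.
have D0 : 0 <= D by rewrite !addr_ge0// mulr_ge0.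
have y4 y : (y - x) ^+ 4 = `|y - x| ^+ 4.
  by rewrite -normrX ger0_norm// exprn_even_ge0.
exists D => // y; have [yr|ry] := ltP `|y - x| r.
  by apply: le_trans (near_x y yr) _; rewrite lerDl mulr_ge0// y4 exprn_ge0.
apply: (@le_trans _ _ (D * (y - x) ^+ 4)); last first.
  by rewrite lerDr mulr_ge0// ?sqr_ge0// ltW.
rewrite [X in `|X|](_ : _ = (F y - F x) - f x * (y - x) - f' x / 2 * (y - x) ^+ 2).
  rewrite y4 /D !mulrDl; apply: le_trans (ler_normB _ _) _; apply: lerD.
    apply: le_trans (ler_normB _ _) _; apply: lerD.
      by apply: le_trans (F_dist y) _; exact: (pow_ge_far (i := 0) (j := 4)).
    by rewrite normrM -mulrA ler_wpM2l//; exact: (pow_ge_far (i := 1) (j := 4)).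
  by rewrite normrM normrX -mulrA ler_wpM2l//; exact: (pow_ge_far (i := 2) (j := 4)).
by ring.
Qed.

Lemma taylor1_global : exists2 C, 0 <= C & forall y,
  `|F y - (F x + f x * (y - x))| <= C * (y - x) ^+ 2.
Proof.
have [r r0 near_x] := taylor2_near cF dF df x0 ltr01.
pose C := (1 + `|f' x / 2|) + (r ^- 2 + `|f x| * r ^- 1).
have r_ge0 i : 0 <= r ^- i by rewrite invr_ge0 exprn_ge0// ltW.
have C1 : 0 <= 1 + `|f' x / 2| by rewrite addr_ge0.
have C2 : 0 <= r ^- 2 + `|f x| * r ^- 1 by rewrite addr_ge0// mulr_ge0.
exists C => [|y]; first exact: addr_ge0.
have y2 : (y - x) ^+ 2 = `|y - x| ^+ 2 by rewrite real_normK ?num_real.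
have [yr|ry] := ltP `|y - x| r.
  apply: (@le_trans _ _ ((1 + `|f' x / 2|) * (y - x) ^+ 2)); last first.
    by rewrite ler_wpM2r ?sqr_ge0// lerDl.
  have := near_x y yr => h.
  rewrite [X in `|X|](_ : _ = F y - (F x + f x * (y - x) + f' x / 2 * (y - x) ^+ 2)
     + f' x / 2 * (y - x) ^+ 2); last by ring.
  rewrite mulrDl; apply: le_trans (ler_normD _ _) _; apply: lerD => //.
  by rewrite normrM normrX y2.
apply: (@le_trans _ _ ((r ^- 2 + `|f x| * r ^- 1) * (y - x) ^+ 2)); last first.
  by rewrite ler_wpM2r ?sqr_ge0// lerDr.
rewrite opprD addrA mulrDl y2; apply: le_trans (ler_normB _ _) _; apply: lerD.
  by apply: le_trans (F_dist y) _; exact: (pow_ge_far (i := 0) (j := 2)).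
by rewrite normrM -mulrA ler_wpM2l//; exact: (pow_ge_far (i := 1) (j := 2)).
Qed.

End taylor.

(** A threshold on m alone suffices here: for n >= 1 the mean of the estimator is free of n and its
    variance is exactly proportional to 1 / n. *)
Lemma is_o_jointP {R : realType} (u v : nat -> nat -> R) :
  (forall e, 0 < e -> exists M, forall m n, (M <= m)%N -> (0 < n)%N ->
    `|u m n / v m n| <= e) ->
  is_o_joint u v.
Proof.
move=> h; apply/cvgrPdist_le => e e0; have [M hM] := h e e0.
exists ([set m | (M <= m)%N], [set n | (0 < n)%N]).
  by split; [exists M|exists 1%N].
by move=> [m n] [/= Mm n0]; rewrite sub0r normrN normr_id; exact: hM.
Qed.

Theorem theorem4 (R : realType) (d : measure_display) (T : measurableType d)
    (P : probability T R) (X : nat -> {RV P >-> R}) (F f f' : R -> R)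
    (X_iid : iid X)
    (X_ge0 : forall i w, 0 <= X i w)
    (X_cdf : forall r, cdf (X 0%N) r = (F r)%:E)
    (F0 : F 0 = 0)
    (F_continuous : continuous F)
    (F_derivative : has_derivative_on `[0, +oo[ F f)
    (f_derivative : has_derivative_on `[0, +oo[ f f')
    (f_regular : continuous_bounded_on `[0, +oo[ f)
    (f'_regular : continuous_bounded_on `[0, +oo[ f')
    (x : R) (x_gt0 : 0 < x) :
  is_o_joint
    (fun m n => bias P (szasz_estimator X m n x) (F x) - m%:R^-1 * bS f' x)
    (fun m n => m%:R^-1)
  /\
  is_o_joint
    (fun m n => var P (szasz_estimator X m n x) -
       (n%:R^-1 * sigma2 F x - (Num.sqrt m%:R)^-1 * n%:R^-1 * VS f x))
    (fun m n => (Num.sqrt m%:R)^-1 * n%:R^-1).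
Proof.
have F01 y : 0 <= F y <= 1.
  by rewrite -!lee_fin -X_cdf cdf_ge0 cdf_le1.
split; apply: is_o_jointP => e e0.
  (* Multiplied by m, the quadratic error has mean e / 2; the other half of e is left for the
     quartic one, at most K / m. *)
  have e1 : 0 < e / 2 / x by rewrite !divr_gt0.
  have [D D0 hD] := taylor2_global F01 F_continuous F_derivative f_derivative x_gt0 e1.
  pose K := D * (x + 3 * x ^+ 2).
  have K0 : 0 <= K by rewrite mulr_ge0// addr_ge0 ?mulr_ge0 ?sqr_ge0// ltW.
  have eK0 : 0 <= 2 * K / e by apply: divr_ge0; [exact: mulr_ge0|exact: ltW].
  exists (Num.bound (2 * K / e)).+1 => m n Mm n0.
  have m0 : (0 < m)%N by apply: leq_trans Mm.
  have m1 : 1 <= m%:R :> R by rewrite ler1n.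
  have mK : 2 * K <= e * m%:R.
    rewrite (mulrC e) -ler_pdivrMr// (le_trans (ltW (archi_boundP eK0)))//.
    by rewrite ler_nat ltnW.
  have [mu [G [Q [[hmu _ _] ES _]]]] :=
    szasz_estimator_moments X_iid X_cdf m (ltW x_gt0) n0.
  have mu_le := mean_taylor2 m0 x_gt0 (fun y _ => hD y) hmu.
  rewrite /bias ES /bS.
  have mR : 0 < m%:R :> R by rewrite ltr0n.
  rewrite invrK normrM (gtr0_norm mR).
  rewrite [X in `|X|](_ : _ = mu - (F x + f' x / 2 * (x / m%:R))); last first.
    by field; rewrite (lt0r_neq0 mR).
  rewrite -ler_pdivlMr// (le_trans mu_le)// ler_pdivlMr//.
  have -> : (e / 2 / x * (x / m%:R) +
      D * (x / m%:R ^+ 3 + 3 * x ^+ 2 / m%:R ^+ 2)) * m%:R =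
    e / 2 + D * (x / m%:R + 3 * x ^+ 2) / m%:R by field; rewrite (lt0r_neq0 mR) (lt0r_neq0 x_gt0).
  suff : D * (x / m%:R + 3 * x ^+ 2) / m%:R <= e / 2 by lra.
  rewrite ler_pdivrMr//; apply: (@le_trans _ _ K); last by lra.
  by rewrite ler_wpM2l// lerD2r ler_pdivrMr// ler_peMr// ltW.
have [C C0 hC] := taylor1_global F01 F_continuous F_derivative f_derivative x_gt0.
(* The part 2 C x + |f x| comes from Q, and another 2 C x from mu^2 - F(x)^2. *)
pose K := 4 * C * x + `|f x|.
have K0 : 0 <= K by rewrite addr_ge0// !mulr_ge0// ltW.
have B0 : 0 <= x^-1 + (K / e) ^+ 2 by rewrite addr_ge0 ?sqr_ge0// invr_ge0 ltW.
(* The summand 1 / x ensures m x >= 1, and (K / e)^2 ensures K / sqrt m <= e; the successor makes m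
   positive. *)
exists (Num.bound (x^-1 + (K / e) ^+ 2)).+1 => m n Mm n0.
have m0 : (0 < m)%N by apply: leq_trans Mm.
have mR : 0 < m%:R :> R by rewrite ltr0n.
have nR : 0 < n%:R :> R by rewrite ltr0n.
have mB : x^-1 + (K / e) ^+ 2 <= m%:R.
  rewrite (le_trans (ltW (archi_boundP B0)))//.
  by rewrite ler_nat ltnW.
have [mu [G [Q [[hmu hG hQ] _ VS_]]]] :=
  szasz_estimator_moments X_iid X_cdf m (ltW x_gt0) n0.
have mx : 1 / 2 <= m%:R * x.
  apply: (@le_trans _ _ 1); first by lra.
  rewrite -ler_pdivrMr// mul1r (le_trans _ mB)// lerDl sqr_ge0//.
have Q_le := mean_min_asymptotics m0 x_gt0 mx C0 (fun y _ => hC y) hG hQ.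
have mu_le : `|mu - F x| <= C * (x / m%:R).
  have := @mean_taylor2 _ F m x (f x) 0 C 0 mu m0 x_gt0.
  rewrite !mul0r !addr0; apply=> // y _.
  by rewrite !mul0r !addr0.
have mu01 : 0 <= mu <= 1.
  have l0 : 0 <= m%:R * x by rewrite mulr_ge0// ltW.
  rewrite (has_mean_le l0 _ (has_mean_cst _ 0) hmu) => [|k]; last by case/andP: (F01 (k%:R / m%:R)).
  by apply: (has_mean_le l0 _ hmu (has_mean_cst _ 1)) => k; case/andP: (F01 (k%:R / m%:R)).
rewrite VS_ /VS /sigma2; set q := Num.sqrt m%:R in Q_le *.
have q0 : 0 < q by rewrite sqrtr_gt0.
have qq : q ^+ 2 = m%:R by rewrite sqr_sqrtr// ltW.
set V := f x * _ in Q_le *.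
(* The factor 1 / n cancels, and mu^2 - F(x)^2 is factored so that the O(1 / m) bound on the bias
   applies. *)
rewrite [X in `|X|](_ : _ = q * (Q - (F x - V / q) - (mu - F x) * (mu + F x))); last first.
  by field; rewrite (lt0r_neq0 q0) (lt0r_neq0 nR).
rewrite normrM (gtr0_norm q0) -ler_pdivlMl//.
apply: (@le_trans _ _ (K / m%:R)).
  apply: le_trans (ler_normB _ _) _.
  rewrite [X in _ <= X](_ : _ = (2 * C * x + `|f x|) / m%:R + C * (x / m%:R) * 2); last first.
    by rewrite /K; field; rewrite lt0r_neq0.
  apply: lerD => //; rewrite normrM; apply: ler_pM => //.
  by have /andP[? ?] := F01 x; have /andP[? ?] := mu01; rewrite ger0_norm; lra.
rewrite ler_pdivrMr// mulrC mulrA -qq.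
rewrite (_ : q ^+ 2 * q^-1 = q); last by field; rewrite lt0r_neq0.
rewrite -ler_pdivrMr//.
rewrite -(@ler_pXn2r _ 2)// ?nnegrE ?divr_ge0 ?(ltW e0) ?(ltW q0)//.
by rewrite qq (le_trans _ mB)// lerDr invr_ge0 ltW.
Qed.
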